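(* Let $G=(I,E)$ be a finite connected graph with unitary resistances ($R_{ij}=1$ for every $\{i,j\}\in E$), let $S^0\subseteq I$ be nonempty, and assume that there is an integer $d$ such that every node $i\in I\setminus S^0$ has degree $d_i=d$. Then the message passing algorithm on $(G,S^0)$ defined in the context converges: for every ordered pair $(i,j)$ with $\{i,j\}\in E$, the sequences $W^{i\to j}(t)$ and $H^{i\to j}(t)$ converge to finite limits as $t\to+\infty$ (and hence so do the estimates $H(i)^{(t)}$, $i\in I\setminus S^0$).
   Context: Graphs are finite, simple and undirected; $N_i$ is the set of neighbors of node $i$ and $d_i=|N_i|$ its degree. No condition is imposed on the degrees of the nodes in $S^0$. Message passing algorithm (MPA) on a general graph with edge resistances $R_{ij}=R_{ji}>0$: to each ordered pair $(i,j)$ with $\{i,j\}\in E$ are associated real messages $W^{i\to j}(t)$, $H^{i\to j}(t)$, $t=0,1,2,\dots$. Initialization: $W^{i\to j}(0)=H^{i\to j}(0)=1$ if $i\notin S^0$, and $W^{i\to j}(0)=H^{i\to j}(0)=0$ if $i\in S^0$. Update: if $i\notin S^0$, $$H^{i\to j}(t+1)=\sum_{k\in N_i\setminus\{j\}}W^{k\to i}(t)H^{k\to i}(t)+1,$$ $$W^{i\to j}(t+1)=\Big(1+R_{ij}\sum_{k\in N_i\setminus\{j\}}\frac{1-W^{k\to i}(t)}{R_{ik}}\Big)^{-1},$$ while if $i\in S^0$, $H^{i\to j}(t+1)=W^{i\to j}(t+1)=0$. (One has $0\le W^{i\to j}(t)\le 1$, so all quantities are well defined.) At time $t$, node $i\in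 I\setminus S^0$ computes the estimate $H(i)^{(t)}=\sum_{k\in N_i}W^{k\to i}(t)H^{k\to i}(t)+1$. *)

(* Defs.v *)
From HB Require Import structures.
From mathcomp Require Import all_boot all_order all_algebra.
From mathcomp Require Import all_classical all_reals all_analysis.
Set Implicit Arguments.
Unset Strict Implicit.
Unset Printing Implicit Defensive.
Import Order.TTheory GRing.Theory Num.Theory.
Import numFieldNormedType.Exports.
Local Open Scope ring_scope.

Definition simple_graph (I : finType) (E : rel I) : Prop :=
  symmetric E /\ irreflexive E.

Definition connected_graph (I : finType) (E : rel I) : Prop :=
  forall i j : I, connect E i j.

Definition nbrs (I : finType) (E : rel I) (i : I) : {set I} :=
  [set k | E i k]%SET.

Definition degree (I : finType) (E : rel I) (i : I) : nat := #|nbrs E i|.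

(* [r i j] is the resistance of the edge {i, j}; the values of [r] and of the
   messages on pairs that are not edges play no role, since every sum below
   ranges over neighbours.  When [r] is positive and symmetric on the edges,
   the messages [mpaW] lie in [0, 1], so the inverted quantity is at least 1
   and the convention 0^-1 = 0 is never used. *)
Fixpoint mpaW (R : realType) (I : finType) (E : rel I) (r : I -> I -> R)
    (S0 : {set I}) (t : nat) (i j : I) : R :=
  if i \in S0 then 0 else
  match t with
  | 0 => 1
  | t'.+1 =>
      (1 + r i j *
         \sum_(k in (nbrs E i :\ j)%SET) (1 - mpaW E r S0 t' k i) / r i k)^-1
  end.

Fixpoint mpaH (R : realType) (I : finType) (E : rel I) (r : I -> I -> R)
    (S0 : {set I}) (t : nat) (i j : I) : R :=
  if i \in S0 then 0 else
  match t with
  | 0 => 1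
  | t'.+1 =>
      \sum_(k in (nbrs E i :\ j)%SET) mpaW E r S0 t' k i * mpaH E r S0 t' k i
      + 1
  end.

Definition mpa_estimate (R : realType) (I : finType) (E : rel I)
    (r : I -> I -> R) (S0 : {set I}) (t : nat) (i : I) : R :=
  \sum_(k in nbrs E i) mpaW E r S0 t k i * mpaH E r S0 t k i + 1.

(* Main.v *)
Require Import Defs.
From HB Require Import structures.
From mathcomp Require Import all_boot all_order all_algebra.
From mathcomp Require Import all_classical all_reals all_analysis.
From mathcomp Require Import lra.
Set Implicit Arguments.
Unset Strict Implicit.
Unset Printing Implicit Defensive.
Import Order.TTheory GRing.Theory Num.Theory.
Import numFieldNormedType.Exports.
Local Open Scope classical_set_scope.
Local Open Scope ring_scope.

(** Write $W_p$ and $H_p$ for the messages on an arc $p = (i, j)$. The arcs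
    $(k, i)$ with $k \in N_i \setminus \{j\}$ feed $p$: following them amounts
    to walking backwards on the graph without ever turning round.

    The messages $W$ obey a monotone recursion of their own and start from the
    largest possible value, so they decrease to a fixed point $W'$
    ([reciprocal_iteration_cvg]). The messages $H$ then obey a linear recursion
    $H(t+1) = A_t H(t) + b$ with nonnegative kernels $A_t$ converging to the
    kernel $A'$ built on $W'$. If the rows of $A'$ have sums at most some
    $c < 1$, then $H$ converges to the fixed point of the limit recursion
    ([cvg_asymptotic_contraction]). Every row of $A'$ has at most $d - 1$ nonzero
    entries, so the theorem reduces to the strict inequality
    $(d-1) \max W' < 1$ ([regular_fixpoint_subcritical]).

    This inequality is where regularity and connectedness enter. Let $m$ be the
    maximum of $W'$, attained at $p$. The fixed point equation at $p$, with
    $d - 1$ feeders of value at most $m$, gives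
    $m (1 + (d-1)(1-m)) \le 1$, that is $(1 - m)((d-1)m - 1) \le 0$. If
    $(d-1)m \ge 1$, then this is an equality, which forces every feeder of $p$
    to have the value $m$ as well. So the set of arcs where $W' = m$ is stable
    under backward walks, and a counting argument shows that such a set of arcs
    leaves from every vertex of the graph ([backward_closed_arcs_cover]). But
    the arcs leaving $S^0$ carry the value $0 < m$. *)

(** * Linear recursions with an asymptotically contracting kernel *)

Lemma cvg_sumr (R : realType) (K : Type) (s : seq K) (P : pred K)
    (f : nat -> K -> R) (l : K -> R) :
  (forall q, P q -> f^~ q @ \oo --> l q) ->
  (fun t => \sum_(q <- s | P q) f t q) @ \oo --> \sum_(q <- s | P q) l q.
Proof. by move=> fl; apply: cvg_big => //; exact: add_continuous. Qed.

(** The iteration of $y \mapsto A y + b$ from $0$ is nondecreasing because $A$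
    and $b$ are nonnegative, and it stays below any constant $B$ with
    $c B + b_p \le B$ for all $p$; its limit is the fixed point. *)
Lemma contraction_fixpoint_exists (R : realType) (K : finType)
    (A : K -> K -> R) (b : K -> R) (c : R) :
  (forall p q, 0 <= A p q) -> (forall p, 0 <= b p) -> 0 <= c -> c < 1 ->
  (forall p, \sum_q A p q <= c) ->
  exists y : K -> R, forall p, y p = \sum_q A p q * y q + b p.
Proof.
move=> A0 b0 c0 c1 rowA.
pose F (y : K -> R) p := \sum_q A p q * y q + b p.
pose y n := iter n F (fun=> 0).
have F_mono u v : (forall p, u p <= v p) -> forall p, F u p <= F v p.
  by move=> uv p; rewrite lerD2r ler_sum// => q _; rewrite ler_wpM2l.
have y_incr n p : y n p <= y n.+1 p.
  elim: n p => [|n IHn] p; last exact: F_mono.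
  by rewrite /y /= /F big1 ?add0r// => q _; rewrite mulr0.
(* The solution of [B = c * B + \sum_p b p]. *)
pose B := (\sum_p b p) / (1 - c).
have B0 : 0 <= B by rewrite divr_ge0 ?sumr_ge0 ?subr_ge0 ?ltW.
have y_le n p : y n p <= B.
  elim: n p => [|n IHn] p //=.
  have -> : B = c * B + \sum_p b p.
    by rewrite -[X in _ + X](@divfK _ (1 - c)) -/B;
      [lra | rewrite subr_eq0 gt_eqF].
  rewrite /F lerD//; last by rewrite (bigD1 p)//= lerDl sumr_ge0.
  apply: (@le_trans _ _ (\sum_q A p q * B)).
    by apply: ler_sum => q _; rewrite ler_wpM2l.
  by rewrite -mulr_suml ler_wpM2r.
have y_cvg p : cvgn (y^~ p).
  apply: nondecreasing_is_cvgn; first by apply/nondecreasing_seqP.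
  by exists B => _ [n _ <-].
exists (fun p => limn (y^~ p)) => p.
have cvg1 : (fun n => y n.+1 p) @ \oo --> limn (y^~ p).
  by rewrite (cvg_shiftS (y^~ p)); exact: y_cvg.
have cvg2 : (fun n => y n.+1 p) @ \oo -->
    \sum_q A p q * limn (y^~ q) + b p.
  apply: cvgD; last exact: cvg_cst.
  by apply: cvg_sumr => q _; apply: cvgMl_tmp; exact: y_cvg.
exact: (cvg_unique _ cvg1 cvg2).
Qed.

(** The distance from $x(t)$ to the fixed point $y$ of the limit recursion
    satisfies $|x(t+1) - y| \le A_t |x(t) - y| + |A_t - A'| |y|$. For large $t$
    the row sums of $A_t$ are at most some $r < 1$ and the last term is at most
    $(1-r) e/2$, so the excess of the distance over $e/2$ is multiplied by $r$
    at each step. *)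
Lemma cvg_asymptotic_contraction (R : realType) (K : finType)
    (A : nat -> K -> K -> R) (A' : K -> K -> R) (b : K -> R)
    (x : nat -> K -> R) (c : R) :
  (forall t p q, 0 <= A t p q) ->
  (forall p q, (fun t => A t p q) @ \oo --> A' p q) ->
  (forall p, 0 <= b p) -> 0 <= c -> c < 1 -> (forall p, \sum_q A' p q <= c) ->
  (forall t p, x t.+1 p = \sum_q A t p q * x t q + b p) ->
  forall p, exists l : R, x^~ p @ \oo --> l.
Proof.
move=> A0 AA' b0 c0 c1 rowA' xS.
have A'0 p q : 0 <= A' p q by apply: (cvgr_to_ge (AA' p q)); near=> t.
have [y yE] := contraction_fixpoint_exists A'0 b0 c0 c1 rowA'.
move=> p0; exists (y p0); apply/cvgrPdist_le => e e0.
pose r := (1 + c) / 2.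
have [r0 r1 cr] : [/\ 0 <= r, r < 1 & c < r] by rewrite /r; split; lra.
have rows : \forall t \near \oo, forall p, \sum_q A t p q <= r.
  apply: filter_forall => p.
  have row_cvg : (fun t => \sum_q A t p q) @ \oo --> \sum_q A' p q.
    exact: cvg_sumr.
  by move/cvgr_le: row_cvg; apply; exact: le_lt_trans (rowA' p) cr.
have errs : \forall t \near \oo, forall p,
    \sum_q `|A t p q - A' p q| * `|y q| <= (1 - r) * (e / 2).
  apply: filter_forall => p.
  have pos : 0 < (1 - r) * (e / 2) by rewrite mulr_gt0 ?divr_gt0 ?subr_gt0.
  have err_cvg : (fun t => \sum_q `|A t p q - A' p q| * `|y q|) @ \oo --> 0.
    rewrite [X in _ --> X](_ : _ = \sum_q `|A' p q - A' p q| * `|y q|);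
      last first.
      by rewrite big1// => q _; rewrite subrr normr0 mul0r.
    apply: cvg_sumr => q _; apply: cvgMr_tmp; apply: cvg_norm.
    by apply: cvgB => //; exact: cvg_cst.
  by move/cvgr_le: err_cvg; apply.
have [N _ HN] := filterI rows errs.
pose B := \sum_p `|x N p - y p|.
have bound n p : `|x (N + n)%N p - y p| <= e / 2 + r ^+ n * B.
  elim: n p => [|n IHn] p.
    rewrite addn0 expr0 mul1r /B (bigD1 p)//=.
    have : 0 <= \sum_(i | i != p) `|x N i - y i| by rewrite sumr_ge0.
    lra.
  have [rowN errN] : (forall p, \sum_q A (N + n)%N p q <= r) /\
      forall p, \sum_q `|A (N + n)%N p q - A' p q| * `|y q| <= (1 - r) * (e / 2).
    by apply: HN; rewrite /= leq_addr.
  set t := (N + n)%N in rowN errN IHn *.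
  have -> : x (N + n.+1)%N p - y p =
      \sum_q (A t p q * (x t q - y q) + (A t p q - A' p q) * y q).
    rewrite addnS xS (yE p) opprD addrACA subrr addr0 -sumrB.
    by apply: eq_bigr => q _; rewrite mulrBr mulrBl; lra.
  apply: le_trans (ler_norm_sum _ _ _) _.
  apply: (@le_trans _ _ (\sum_q (A t p q * (e / 2 + r ^+ n * B) +
                                 `|A t p q - A' p q| * `|y q|))).
    apply: ler_sum => q _; apply: le_trans (ler_normD _ _) _.
    by rewrite !normrM (ger0_norm (A0 _ _ _)) lerD2r ler_wpM2l.
  rewrite big_split /= -mulr_suml.
  have : (\sum_q A t p q) * (e / 2 + r ^+ n * B) <= r * (e / 2 + r ^+ n * B).
    rewrite ler_wpM2r ?rowN// addr_ge0//; first by rewrite divr_ge0 ?ltW.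
    by rewrite mulr_ge0 ?exprn_ge0// sumr_ge0.
  have := errN p; rewrite exprS; lra.
have small : \forall n \near \oo, r ^+ n * B <= e / 2.
  have r_cvg : (fun n => r ^+ n * B) @ \oo --> 0.
    by rewrite -[X in _ --> X](mul0r B); apply: cvgMr_tmp;
      apply: cvg_expr; rewrite ger0_norm.
  by move/cvgr_le: r_cvg; apply; rewrite divr_gt0.
have [M _ HM] := small.
exists (N + M)%N => // t /= NMt.
have Nt : (N <= t)%N by apply: leq_trans NMt; rewrite leq_addr.
rewrite distrC -(subnKC Nt); apply: le_trans (bound _ _) _.
have := HM (t - N)%N; rewrite /= leq_subRL// => /(_ NMt); lra.
Unshelve. all: by end_near.
Qed.

(** * Sets of arcs closed under backward non-backtracking walks *)

(** A vertex with one outgoing arc in [C] receives at least one arc of [C],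
    since its degree is at least 2, and a vertex with two outgoing arcs receives
    one from each of its neighbours. So the in-degree in [C] is at least the
    out-degree at every vertex; both add up to the number of arcs of [C], hence
    they agree everywhere. Then the head of an arc of [C] is the tail of another
    one, and the vertices that are tails of arcs of [C] are closed under
    adjacency. *)
Lemma backward_closed_arcs_cover (I : finType) (E C : rel I) :
  symmetric E -> connected_graph E ->
  (forall i j, C i j -> E i j) ->
  (forall i j, C i j -> (1 < degree E i)%N) ->
  (forall i j k, C i j -> E i k -> k != j -> C k i) ->
  forall i j, C i j -> forall v, exists u, C v u.
Proof.
move=> Esym conn CE Cdeg Cback i0 j0 Cij0 v.
pose outd i := #|[set j | C i j]%SET|.
pose ind i := #|[set k | C k i]%SET|.
have out_le_in i : (outd i <= ind i)%N.
  have [out0|[j]] := set_0Vmem [set j | C i j]%SET.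
    by rewrite /outd out0 cards0.
  rewrite inE => Cij.
  (* With two distinct heads, no neighbour of [i] is excluded by both. *)
  have [j' /andP[Cij' jj']|only_j] := pickP [pred j' | C i j' && (j' != j)].
    apply: subset_leq_card; apply/fintype.subsetP => k; rewrite !inE => /CE Eik.
    have [kj|kj] := eqVneq k j; last exact: Cback Cij Eik kj.
    by apply: Cback Cij' Eik _; rewrite kj eq_sym.
  have -> : outd i = 1%N.
    apply/eqP/cards1P; exists j; apply/setP => k; rewrite !inE.
    have := only_j k; rewrite /=; have [->//|_] := eqVneq k j.
    by rewrite andbT.
  have : (0 < #|nbrs E i :\ j|%SET)%N.
    have := Cdeg _ _ Cij; rewrite /degree (cardsD1 j) inE (CE _ _ Cij).
    by rewrite add1n ltnS.
  case/card_gt0P => k; rewrite !inE => /andP[kj Eik].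
  by apply/card_gt0P; exists k; rewrite inE (Cback _ _ _ Cij Eik kj).
have sum_eq : (\sum_i outd i = \sum_i ind i)%N.
  have cardE (P : pred I) : #|[set j | P j]%SET| = (\sum_j P j)%N.
    by rewrite -sum1_card big_mkcond; apply: eq_bigr => j _; rewrite inE.
  under eq_bigr => i _ do rewrite /outd cardE.
  under [RHS]eq_bigr => i _ do rewrite /ind cardE.
  exact: exchange_big.
have in_out i : outd i = ind i.
  have := leqif_sum (fun i (_ : true) => leqif_eq (out_le_in i)).
  by case=> _; rewrite sum_eq eqxx => /esym/forallP/(_ i)/eqP.
have out_of_in i k : C k i -> (0 < outd i)%N.
  by move=> Cki; rewrite in_out; apply/card_gt0P; exists k; rewrite inE.
(* The neighbour [j] that [Cback] excludes is reached by the arc [(i, j)]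
   itself: an incoming arc at [j] means an outgoing one. *)
have closedX : fingraph.closed E [pred i | (0 < outd i)%N].
  apply: intro_closed; first by move=> a b; apply: sym_connect_sym.
  move=> i k Eik /card_gt0P[j]; rewrite inE => Cij; rewrite inE.
  have [->|kj] := eqVneq k j; first exact: out_of_in Cij.
  by apply/card_gt0P; exists i; rewrite inE (Cback _ _ _ Cij).
have : (0 < outd v)%N.
  have := closed_connect closedX (conn i0 v); rewrite !inE => <-.
  by apply/card_gt0P; exists j0; rewrite inE.
by case/card_gt0P => u; rewrite inE; exists u.
Qed.

(** * The messages [W] *)

(** The arcs whose messages evolve: a node of [S0] sends zero for ever. *)
Definition live (I : finType) (E : rel I) (S0 : {set I}) : pred (I * I) :=
  fun p => E p.1 p.2 && (p.1 \notin S0).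

(** The arcs whose messages enter the update of the message on [p]. *)
Definition feeders (I : finType) (E : rel I) (p : I * I) : {set I * I} :=
  [set q | [&& q.2 == p.1, E q.1 q.2 & q.1 != p.2]]%SET.

Lemma sum_feeders (R : realType) (I : finType) (E : rel I) (F : I -> I -> R)
    (i j : I) :
  symmetric E ->
  \sum_(k in (nbrs E i :\ j)%SET) F k i =
  \sum_(q in feeders E (i, j)) F q.1 q.2.
Proof.
move=> Esym; rewrite (reindex_onto (fun k => (k, i)) fst) /=; last first.
  by case=> k l; rewrite inE /= => /and3P[/eqP-> _ _].
by apply: eq_bigl => k; rewrite !inE /= !eqxx andbT Esym /= andbC.
Qed.

Lemma card_feeders (I : finType) (E : rel I) (i j : I) :
  symmetric E -> E i j -> #|feeders E (i, j)| = (degree E i).-1.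
Proof.
move=> Esym Eij.
have -> : feeders E (i, j) = [set (k, i) | k in (nbrs E i :\ j)%SET]%SET.
  apply/setP => -[k l]; rewrite inE /=; apply/and3P/imsetP => /=.
    by case=> /eqP-> Eki kj; exists k; rewrite // !inE kj Esym.
  by case=> k' + [-> ->]; rewrite !inE eqxx Esym => /andP[].
rewrite card_imset; last by move=> k k' [].
by rewrite /degree (cardsD1 j (nbrs E i)) inE Eij.
Qed.

(** As a function of $w$, the right-hand side is nondecreasing with values in
    $[0, 1]$, and the iteration starts at its largest conceivable value, so it
    decreases. The denominators stay at least 1, which makes the right-hand side
    continuous at the limit. *)
Lemma reciprocal_iteration_cvg (R : realType) (K : finType) (N : K -> {set K})
    (L : pred K) (w : nat -> K -> R) :
  (forall p, w 0%N p = (L p)%:R) ->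
  (forall t p, w t.+1 p =
     if L p then (1 + \sum_(q in N p) (1 - w t q))^-1 else 0) ->
  exists w' : K -> R,
    [/\ forall p, w^~ p @ \oo --> w' p,
        forall t p, 0 <= w t p,
        forall p, 0 <= w' p <= 1 &
        forall p, w' p =
          if L p then (1 + \sum_(q in N p) (1 - w' q))^-1 else 0].
Proof.
move=> w0 wS.
have w01 t p : 0 <= w t p <= 1.
  elim: t p => [|t IHt] p.
    by rewrite w0; case: (L p); rewrite /= ?lexx ?ler01.
  rewrite wS; case: (L p); last by rewrite lexx ler01.
  have s0 : 0 <= \sum_(q in N p) (1 - w t q).
    by apply: sumr_ge0 => q _; rewrite subr_ge0; case/andP: (IHt q).
  by rewrite invr_ge0 addr_ge0//= invf_le1 ?lerDl// ltr_wpDr.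
have den_gt0 (u : K -> R) p : (forall q, u q <= 1) ->
    0 < 1 + \sum_(q in N p) (1 - u q).
  by move=> u1; rewrite ltr_wpDr// sumr_ge0// => q _; rewrite subr_ge0.
have w1 t p : w t p <= 1 by case/andP: (w01 t p).
have w_decr t p : w t.+1 p <= w t p.
  elim: t p => [|t IHt] p.
    by have := w01 1%N p; rewrite w0 wS; case: (L p) => //= /andP[].
  rewrite (wS t.+1 p) (wS t p); case: (L p) => //.
  by rewrite lef_pV2 ?posrE ?den_gt0// lerD2l ler_sum// => q _; rewrite lerB.
have w_cvg p : cvgn (w^~ p).
  apply: nonincreasing_is_cvgn; first by apply/nonincreasing_seqP.
  by exists 0 => _ [t _ <-]; case/andP: (w01 t p).
have w'01 p : 0 <= limn (w^~ p) <= 1.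
  by apply/andP; split; [apply: limr_ge | apply: limr_le] => //;
    near=> t; case/andP: (w01 t p).
exists (fun p => limn (w^~ p)); split => //.
  by move=> t p; case/andP: (w01 t p).
move=> p.
have cvg1 : (fun t => w t.+1 p) @ \oo --> limn (w^~ p).
  by rewrite (cvg_shiftS (w^~ p)); exact: w_cvg.
apply: (cvg_unique _ cvg1) => //.
have -> : (fun t => w t.+1 p) = (fun t =>
    if L p then (1 + \sum_(q in N p) (1 - w t q))^-1 else 0).
  by apply/funext => t; rewrite wS.
case: (L p); last exact: cvg_cst.
apply: cvgV.
  by rewrite gt_eqF// den_gt0// => q; case/andP: (w'01 q).
apply: cvgD; first exact: cvg_cst.
apply: cvg_sumr => q _; apply: cvgB; first exact: cvg_cst.
exact: w_cvg.
Unshelve. all: by end_near.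
Qed.

(** The bound is strict because of [S0]. With [S0] empty and $d \ge 2$,
    the constants $1$ and $1/(d-1)$ are both fixed points, and they are the two
    values for which the equation at a maximal arc leaves no slack when
    $(d-1) \max w \ge 1$. Having no slack propagates backwards from the maximal
    arc over the whole graph and reaches [S0], where $w$ vanishes. *)
Lemma regular_fixpoint_subcritical (R : realType) (I : finType) (E : rel I)
    (S0 : {set I}) (d : nat) (w : I * I -> R) :
  symmetric E -> connected_graph E -> (exists s : I, s \in S0) ->
  (forall i : I, i \notin S0 -> degree E i = d) ->
  (forall p, 0 <= w p <= 1) ->
  (forall p, w p =
     if live E S0 p then (1 + \sum_(q in feeders E p) (1 - w q))^-1 else 0) ->
  forall p, d.-1%:R * w p < 1.
Proof.
move=> Esym conn [s sS0] hdeg w01 wfix p0.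
have [d1|d1] := leqP d 1.
  by rewrite (_ : d.-1 = 0%N) ?mul0r ?ltr01//; case: d d1 {hdeg} => [|[]].
have [p _ p_max] : extremum_spec >=%O xpredT w [arg max_(p > p0 | true) w p]%O.
  exact: arg_maxP.
set m := w p in p_max.
have le_m q : w q <= m by exact: p_max.
suff dm : d.-1%:R * m < 1 by apply: le_lt_trans dm; rewrite ler_wpM2l.
rewrite ltNge; apply/negP => dm.
have m1 : m <= 1 by case/andP: (w01 p).
have m0 : 0 < m.
  rewrite lt_neqAle; case/andP: (w01 p) => -> _; rewrite andbT.
  by apply/eqP => m0; move: dm; rewrite -m0 mulr0 ler10.
have m_live q : w q = m -> live E S0 q.
  by rewrite wfix; case: ifP => // _ m0'; move: m0; rewrite -m0' ltxx.
have m_feeders i j q : w (i, j) = m -> q \in feeders E (i, j) -> w q = m.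
  move=> wij qN; apply/eqP; rewrite eq_le le_m /= leNgt; apply/negP => wq.
  have lij := m_live _ wij; have /andP[/= Eij iS0] := lij.
  have card_N : #|feeders E (i, j)| = d.-1 by rewrite card_feeders ?hdeg.
  have sum_gt : d.-1%:R * (1 - m) < \sum_(q in feeders E (i, j)) (1 - w q).
    rewrite mulr_natl -card_N -sumr_const (bigD1 q qN) [ltRHS](bigD1 q qN) /=.
    by rewrite ltr_leD ?ler_sum ?ltrD2l ?ltrN2// => l _; rewrite lerB.
  have := wfix (i, j); rewrite lij wij => mE.
  have den0 : 1 + \sum_(q in feeders E (i, j)) (1 - w q) != 0.
    by apply/eqP => den0; move: m0; rewrite mE den0 invr0 ltxx.
  have : m * (1 + \sum_(q in feeders E (i, j)) (1 - w q)) = 1.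
    by rewrite {1}mE mulVf.
  have : m * (d.-1%:R * (1 - m)) < m * \sum_(q in feeders E (i, j)) (1 - w q).
    by rewrite ltr_pM2l.
  have : 0 <= (1 - m) * (d.-1%:R * m - 1) by rewrite mulr_ge0 ?subr_ge0.
  (* $1 = m (1 + x) > m (1 + n(1-m)) = 1 + (1-m)(n m - 1) \ge 1$ *)
  set x := \sum_(_ in _) _; set n : R := d.-1%:R; nra.
have [] := @backward_closed_arcs_cover I E (fun i j => w (i, j) == m) Esym conn
  _ _ _ p.1 p.2 _ s.
- by move=> i j /eqP/m_live/andP[].
- by move=> i j /eqP/m_live/andP[_ /hdeg->].
- move=> i j k /eqP wij Eik kj; apply/eqP; apply: m_feeders wij _.
  by rewrite inE /= eqxx Esym Eik.
- by rewrite -surjective_pairing.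
by move=> u /eqP/m_live/andP[_]; rewrite sS0.
Qed.

(** * The algorithm as a pair of recursions on arcs *)

(** The messages are also defined on pairs that are not edges, where the update
    involves unspecified resistances; setting them to zero there gives
    recursions valid on the whole finite type [I * I]. *)
Definition on_live (R : realType) (I : finType) (E : rel I) (S0 : {set I})
    (u : nat -> I -> I -> R) (t : nat) (p : I * I) : R :=
  if live E S0 p then u t p.1 p.2 else 0.

Lemma mpaW_on_live (R : realType) (I : finType) (E : rel I) (r : I -> I -> R)
    (S0 : {set I}) (t : nat) (i j : I) :
  E i j -> mpaW E r S0 t i j = on_live E S0 (mpaW E r S0) t (i, j).
Proof.
move=> Eij; rewrite /on_live /live /= Eij; case: ifPn => // /negPn.
by case: t => [|t] /= ->.
Qed.

Lemma mpaH_on_live (R : realType) (I : finType) (E : rel I) (r : I -> I -> R)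
    (S0 : {set I}) (t : nat) (i j : I) :
  E i j -> mpaH E r S0 t i j = on_live E S0 (mpaH E r S0) t (i, j).
Proof.
move=> Eij; rewrite /on_live /live /= Eij; case: ifPn => // /negPn.
by case: t => [|t] /= ->.
Qed.

Lemma on_live_mpaW0 (R : realType) (I : finType) (E : rel I)
    (r : I -> I -> R) (S0 : {set I}) (p : I * I) :
  on_live E S0 (mpaW E r S0) 0 p = (live E S0 p)%:R.
Proof. by rewrite /on_live /live; case: ifP => //= /andP[_ /negbTE->]. Qed.

Lemma on_live_mpaWS (R : realType) (I : finType) (E : rel I)
    (r : I -> I -> R) (S0 : {set I}) (t : nat) (p : I * I) :
  symmetric E -> (forall i j, E i j -> r i j = 1) ->
  on_live E S0 (mpaW E r S0) t.+1 p =
  if live E S0 p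
  then (1 + \sum_(q in feeders E p) (1 - on_live E S0 (mpaW E r S0) t q))^-1
  else 0.
Proof.
move=> Esym r1; rewrite [LHS]/on_live; case: ifP => //.
case: p => i j /andP[/= Eij /negbTE->].
rewrite r1// mul1r; congr (1 + _)^-1.
rewrite -(@sum_feeders R I E (fun k l =>
  1 - on_live E S0 (mpaW E r S0) t (k, l)))//.
  apply: eq_bigr => k; rewrite !inE => /andP[_ Eik].
  by rewrite r1// divr1 -mpaW_on_live// Esym.
Qed.

Lemma on_live_mpaHS (R : realType) (I : finType) (E : rel I)
    (r : I -> I -> R) (S0 : {set I}) (t : nat) (p : I * I) :
  symmetric E ->
  on_live E S0 (mpaH E r S0) t.+1 p =
  \sum_q (if live E S0 p && (q \in feeders E p)
          then on_live E S0 (mpaW E r S0) t q else 0) *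
         on_live E S0 (mpaH E r S0) t q + (live E S0 p)%:R.
Proof.
move=> Esym; rewrite [LHS]/on_live.
case: (boolP (live E S0 p)) => [|_]; last first.
  by rewrite big1 ?addr0// => q _; rewrite mul0r.
case: p => i j /andP[/= Eij /negbTE->]; congr (_ + 1).
transitivity (\sum_(q in feeders E (i, j)) on_live E S0 (mpaW E r S0) t q *
                                           on_live E S0 (mpaH E r S0) t q).
  rewrite -(@sum_feeders R I E (fun k l => on_live E S0 (mpaW E r S0) t (k, l) *
    on_live E S0 (mpaH E r S0) t (k, l)))//.
  apply: eq_bigr => k; rewrite !inE => /andP[_ Eik].
  by rewrite -mpaW_on_live -?mpaH_on_live// Esym.
rewrite big_mkcond; apply: eq_bigr => q _.
by case: ifP => //; rewrite mul0r.
Qed.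

Theorem theorem6 (R : realType) (I : finType) (E : rel I) (r : I -> I -> R)
    (S0 : {set I}) (d : nat)
    (hG : simple_graph E) (hconn : connected_graph E)
    (hr : forall i j : I, E i j -> r i j = 1)
    (hS0 : exists s : I, s \in S0)
    (hdeg : forall i : I, i \notin S0 -> degree E i = d) :
  (forall i j : I, E i j ->
     (exists w : R, (fun t : nat => mpaW E r S0 t i j) @ \oo --> w) /\
     (exists h : R, (fun t : nat => mpaH E r S0 t i j) @ \oo --> h)) /\
  (forall i : I, i \notin S0 ->
     exists h : R, (fun t : nat => mpa_estimate E r S0 t i) @ \oo --> h).
Proof.
have [Esym _] := hG.
pose w := on_live E S0 (mpaW E r S0).
pose h := on_live E S0 (mpaH E r S0).
have wS t p := on_live_mpaWS S0 t p Esym hr.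
have [w' [w_cvg w_ge0 w'01 w'_fix]] :=
  reciprocal_iteration_cvg (on_live_mpaW0 E r S0) wS.
have w'_lt := regular_fixpoint_subcritical Esym hconn hS0 hdeg w'01 w'_fix.
have [s _] := hS0.
(* A maximum needs an inhabitant of the index type, here [(s, s)]. *)
have [p _ p_max] :
  extremum_spec >=%O xpredT w' [arg max_(p > (s, s) | true) w' p]%O.
  exact: arg_maxP.
have h_cvg : forall p, exists l : R, h^~ p @ \oo --> l.
  apply: (@cvg_asymptotic_contraction R _
    (fun t p q => if live E S0 p && (q \in feeders E p) then w t q else 0)
    (fun p q => if live E S0 p && (q \in feeders E p) then w' q else 0)
    (fun p => (live E S0 p)%:R) h (d.-1%:R * w' p)) => //.
  - by move=> t p1 q; case: ifP => // _; exact: w_ge0.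
  - move=> p1 q; case: ifP => _; first exact: w_cvg.
    exact: cvg_cst.
  - by rewrite mulr_ge0//; case/andP: (w'01 p).
  - case=> i j.
    have [/andP[/= Eij iS0]|_] := boolP (live E S0 (i, j)); last first.
      by rewrite big1// mulr_ge0//; case/andP: (w'01 p).
    rewrite -big_mkcond -(hdeg _ iS0) -(card_feeders Esym Eij) mulr_natl.
    by rewrite -sumr_const ler_sum// => q _; exact: p_max.
  by move=> t p1; exact: on_live_mpaHS.
have arc_cvg i j : E i j ->
    (exists l : R, (fun t => mpaW E r S0 t i j) @ \oo --> l) /\
    (exists l : R, (fun t => mpaH E r S0 t i j) @ \oo --> l).
  move=> Eij; split.
    exists (w' (i, j)); rewrite (funext (fun t => mpaW_on_live r S0 t Eij)).
    exact: w_cvg.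
  have [l hl] := h_cvg (i, j); exists l.
  by rewrite (funext (fun t => mpaH_on_live r S0 t Eij)).
split=> // i _.
have [l hl] := choice h_cvg.
exists (\sum_(k in nbrs E i) w' (k, i) * l (k, i) + 1).
apply: cvgD; last exact: cvg_cst.
apply: cvg_sumr => k; rewrite inE => Eik.
have Eki : E k i by rewrite Esym.
by apply: cvgM; [rewrite (funext (fun t => mpaW_on_live r S0 t Eki)) |
  rewrite (funext (fun t => mpaH_on_live r S0 t Eki))].
Qed.
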